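(* For all positive integers $k\geq 3$, if $n$ is large enough (depending on $k$), then every $p\in S_n$ has a $2$-inverse-additive subsequence of length $k$.
   Context: $S_n$ denotes the set of permutations of $\{1,2,\ldots,n\}$ written in one-line notation $p=(p_1,p_2,\ldots,p_n)$. A subsequence of $p$ of length $k$ is a sequence $(p_{i_1},\ldots,p_{i_k})$ with $i_1<\cdots<i_k$. A sequence $(a_1,a_2,\ldots,a_k)$ of positive integers is $2$-inverse-additive if $1/a_1+1/a_2+\cdots+1/a_k=2/a_1$ or $1/a_1+1/a_2+\cdots+1/a_k=2/a_k$. *)

(* Defs.v *)
From HB Require Import structures.
From mathcomp Require Import all_boot all_order all_fingroup all_algebra.

Set Implicit Arguments.
Unset Strict Implicit.
Unset Printing Implicit Defensive.

Import Order.TTheory GRing.Theory Num.Theory.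
Local Open Scope ring_scope.

(* 'S_n permutes {0, ..., n-1}; the shift by one makes it a permutation of
   {1, ..., n}. *)
Definition one_line (n : nat) (p : 'S_n) : seq nat :=
  [seq (p i : nat).+1 | i <- enum 'I_n].

Definition two_inverse_additive (a : seq nat) : Prop :=
  if a is a1 :: a' then
    all (fun x => 0 < x)%N a /\
    (\sum_(x <- a) (x%:R : rat)^-1 = 2 / a1%:R \/
     \sum_(x <- a) (x%:R : rat)^-1 = 2 / (last a1 a')%:R)
  else False.

(* Main.v *)
Require Import Defs.
From HB Require Import structures.
From mathcomp Require Import all_boot all_order all_fingroup all_algebra.
From Stdlib Require Import Classical.
From mathcomp Require Import zify ring.

(** The reciprocals of the divisors [L / v] of [L := M`!], for [1 <= v <= M],
    are [v / L].  A permutation of [{1, ..., n}] with [L <= n] orders these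
    divisors, hence orders [{1, ..., M}], and a relation [1/a = 1/b_1 + ... +
    1/b_m] between divisors is a relation [x = y_1 + ... + y_m] between the
    corresponding [v]'s.  So, with [m = k - 1 = h + 1], it is enough to find
    distinct [y_1, ..., y_m] whose sum [x <= M] comes before all of them or
    after all of them ([extremal_sum]).

    Suppose that there are none: the sum of [m] distinct numbers always lies
    strictly between two of them.  Cut the order into a lower class and an
    upper class.  Each class is then closed under sums of [m] distinct
    elements, and this forces much more ([closed_multiples]): if [S] is the sum
    of [m] distinct elements of a class, then the class contains every [q * S]
    with [q = 1] modulo [h].  Now take [2 m] numbers congruent to [1] modulo
    [h], and cut the order between the first [m] of them, of sum [S], and the
    last [m], of sum [T].  Both [S] and [T] are congruent to [m], that is to
    [1], modulo [h], so that the single number [S * T] belongs to both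
    classes. *)

(** * Sums of distinct elements in an ordered initial segment *)

Definition sum_closed (m M : nat) (C : pred nat) :=
  forall ys : seq nat, uniq ys -> size ys = m -> all (leq 1) ys -> all C ys ->
    \sum_(y <- ys) y <= M -> C (\sum_(y <- ys) y).

(** An element [T >= S] of the class differs from every [y] in [s], so [T] can
    be added to the [h] elements of [s] other than [y]: this gives
    [T + (S - y)].  The elements of [s] can be reused at each step. *)
Lemma closed_add_complements {h M : nat} {C : pred nat} {s : seq nat} :
    0 < h -> sum_closed h.+1 M C ->
    uniq s -> size s = h.+1 -> all (leq 1) s -> all C s ->
  forall (r : seq nat) (T : nat), {subset r <= s} -> C T ->
    \sum_(y <- s) y <= T -> T + \sum_(y <- r) (\sum_(z <- s) z - y) <= M ->
  C (T + \sum_(y <- r) (\sum_(z <- s) z - y)).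
Proof.
move=> h_gt0 clC us sz_s s_gt0 sC; elim=> [|y r IHr] T rs CT leST.
  by rewrite big_nil addn0.
rewrite big_cons addnA => leM.
have ys : y \in s by apply: rs; rewrite mem_head.
have defS : \sum_(z <- s) z = y + \sum_(z <- rem y s) z by rewrite (big_rem y).
have memS z : z \in s -> z < \sum_(z <- s) z.
  move=> zs; rewrite (big_rem z) //=.
  have : 0 < size (rem z s) by rewrite size_rem // sz_s.
  case def_r: (rem z s) => [//|u r'] _; rewrite big_cons.
  have : u \in s by apply: (mem_rem (x := z)); rewrite def_r mem_head.
  by move/(allP s_gt0); lia.
have defT : T + (\sum_(z <- s) z - y) = \sum_(z <- T :: rem y s) z.
  by rewrite big_cons defS addKn.
apply: IHr => //; last by lia.
  by move=> z rz; apply: rs; rewrite inE rz orbT.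
have sub_all (P : pred nat) : all P s -> all P (rem y s).
  by move=> /allP Ps; apply/allP=> z /mem_rem /Ps.
rewrite defT; apply: clC => /=.
- rewrite rem_uniq // andbT; apply/negP=> /mem_rem /memS; lia.
- by rewrite size_rem // sz_s.
- by rewrite sub_all // andbT; move: (memS y ys); lia.
- by rewrite CT sub_all.
- by rewrite -defT; apply: leq_trans leM; apply: leq_addr.
Qed.

(** Adding to [T] the complement [S - y] of each [y] in [s] once increases it
    by [h.+1 * S - S = h * S]. *)
Lemma closed_multiples {h M : nat} {C : pred nat} {s : seq nat} :
    0 < h -> sum_closed h.+1 M C ->
    uniq s -> size s = h.+1 -> all (leq 1) s -> all C s ->
  forall j : nat, (1 + j * h) * \sum_(y <- s) y <= M ->
  C ((1 + j * h) * \sum_(y <- s) y).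
Proof.
move=> h_gt0 clC us sz_s s_gt0 sC; elim=> [|j IHj].
  by rewrite mul1n => leM; apply: clC.
have total : \sum_(y <- s) (\sum_(z <- s) z - y) = h * \sum_(z <- s) z.
  have : \sum_(y <- s) (\sum_(z <- s) z - y) + \sum_(y <- s) y
         = h.+1 * \sum_(z <- s) z.
    rewrite -big_split /= (eq_big_seq (fun=> \sum_(z <- s) z)); last first.
      by move=> y ys; rewrite subnK // (big_rem y) //= leq_addr.
    by rewrite big_const_seq count_predT sz_s iter_addn_0 mulnC.
  by rewrite mulSn; lia.
have -> : (1 + j.+1 * h) * \sum_(y <- s) y
          = (1 + j * h) * \sum_(y <- s) y
            + \sum_(y <- s) (\sum_(z <- s) z - y).
  by rewrite total; ring.
move=> leM; apply: (closed_add_complements h_gt0 clC) => //.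
  by apply: IHj; apply: leq_trans leM; apply: leq_addr.
by rewrite mulnDl mul1n leq_addr.
Qed.

Lemma sum_1mod {h : nat} {s : seq nat} :
    size s = h.+1 -> {in s, forall x, exists i, x = 1 + i * h} ->
  exists j, \sum_(x <- s) x = 1 + j * h.
Proof.
move=> sz_s s1; suff [j ->] : exists j, \sum_(x <- s) x = size s + j * h.
  by exists j.+1; rewrite sz_s; ring.
elim: s s1 {sz_s} => [|x s IHs] s1; first by exists 0; rewrite big_nil.
have [i ->] := s1 x (mem_head x s).
have [j sj] : exists j, \sum_(y <- s) y = size s + j * h.
  by apply: IHs => y sy; apply: s1; rewrite inE sy orbT.
by exists (i + j); rewrite big_cons sj /=; ring.
Qed.

(** The additive core: [f] ranks the numbers [1, ..., M].  Multiples of [S] in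
    the lower class and multiples of [T] in the upper class meet at [S * T]
    because both cofactors, [T] and [S], are [1] modulo [h]; this is why the
    candidates [cand] are chosen congruent to [1].  All sums formed on the way
    are at most [S * T], hence at most the square of the sum of [cand]. *)
Theorem extremal_sum (h : nat) (h_gt0 : 0 < h) :
  exists M, forall f : nat -> nat,
    {in [pred v | 0 < v <= M] &, injective f} ->
  exists ys : seq nat,
    [/\ uniq ys, size ys = h.+1, all (leq 1) ys, \sum_(y <- ys) y <= M
      & all (fun y => f (\sum_(y <- ys) y) < f y) ys
        \/ all (fun y => f y < f (\sum_(y <- ys) y)) ys].
Proof.
pose cand := [seq 1 + i * h | i <- iota 0 (h.+1 + h.+1)].
pose W := \sum_(x <- cand) x.
have ucand : uniq cand.
  rewrite map_inj_uniq ?iota_uniq // => i j /= /eqP.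
  by rewrite eqn_add2l eqn_pmul2r // => /eqP.
exists (W * W) => f f_inj; apply: NNPP => noext.
(* The sum of distinct elements is bounded on both sides by some of them. *)
have mid ys : uniq ys -> size ys = h.+1 -> all (leq 1) ys ->
    \sum_(y <- ys) y <= W * W ->
  (exists2 y, y \in ys & f y <= f (\sum_(y <- ys) y))
  /\ (exists2 y, y \in ys & f (\sum_(y <- ys) y) <= f y).
  move=> uys szys ys0 leM; split.
    have /allPn[y yys] : ~~ all (fun y => f (\sum_(y <- ys) y) < f y) ys.
      by apply/negP=> H; apply: noext; exists ys; split=> //; left.
    by rewrite -leqNgt; exists y.
  have /allPn[y yys] : ~~ all (fun y => f y < f (\sum_(y <- ys) y)) ys.
    by apply/negP=> H; apply: noext; exists ys; split=> //; right.
  by rewrite -leqNgt; exists y.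
pose s := sort (relpre f leq) cand.
pose A := take h.+1 s; pose B := drop h.+1 s.
have sz_s : size s = h.+1 + h.+1 by rewrite size_sort size_map size_iota.
have szA : size A = h.+1 by rewrite size_takel // sz_s leq_addr.
have szB : size B = h.+1 by rewrite size_drop sz_s addKn.
have defs : A ++ B = s by apply: cat_take_drop.
have us : uniq s by rewrite sort_uniq.
have WAB : \sum_(x <- A) x + \sum_(x <- B) x = W.
  by rewrite -big_cat defs; apply: perm_big; apply/permPl/perm_sort.
move: (us); rewrite -defs cat_uniq => /and3P[uA disjAB uB].
have sA x : x \in A -> x \in cand.
  by move=> /mem_take; rewrite mem_sort.
have sB x : x \in B -> x \in cand.
  by move=> /mem_drop; rewrite mem_sort.
have cand0 x : x \in cand -> 0 < x by move=> /mapP[i _ ->].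
have cand1 x : x \in cand -> exists i, x = 1 + i * h.
  by move=> /mapP[i _ ->]; exists i.
have candM x : x \in cand -> 0 < x <= W * W.
  move=> xc; have x0 := cand0 x xc; rewrite x0 /=.
  have xW : x <= W by rewrite /W (big_rem x) //= leq_addr.
  by apply: (leq_trans xW); apply: leq_pmulr; apply: leq_trans x0 xW.
have ltAB a b : a \in A -> b \in B -> f a < f b.
  move=> aA bB; have : sorted (relpre f leq) s.
    by apply: sort_sorted => x y; apply: leq_total.
  rewrite sorted_pairwise; last by move=> x y z; apply: leq_trans.
  rewrite -defs pairwise_cat => /and3P[/allrelP/(_ a b aA bB) /= leab _ _].
  rewrite ltn_neqAle leab andbT; apply/negP=> /eqP /f_inj eab.
  move/hasP: disjAB; apply; exists b => //=.
  by rewrite -eab //; apply: candM; [apply: sA | apply: sB].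
(* The lower class of the cut: what comes strictly before all of [B]. *)
pose low x := all (fun b => f x < f b) B.
have low_closed : sum_closed h.+1 (W * W) low.
  move=> ys uys szys ys0 yslow leM.
  have [_ [y yys leSy]] := mid ys uys szys ys0 leM.
  apply/allP=> b bB; apply: leq_ltn_trans leSy _.
  by apply: (allP (allP yslow y yys)).
have up_closed : sum_closed h.+1 (W * W) (predC low).
  move=> ys uys szys ys0 ysup leM.
  have [[y yys leyS] _] := mid ys uys szys ys0 leM.
  have /allPn[b bB] := allP ysup y yys; rewrite -leqNgt => leby.
  by apply/allPn; exists b; rewrite // -leqNgt (leq_trans leby).
have [i SA] : exists i, \sum_(x <- A) x = 1 + i * h.
  by apply: sum_1mod => // x /sA /cand1.
have [j SB] : exists j, \sum_(x <- B) x = 1 + j * h.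
  by apply: sum_1mod => // x /sB /cand1.
have leM : (\sum_(x <- A) x) * (\sum_(x <- B) x) <= W * W.
  by apply: leq_mul; rewrite -WAB ?leq_addr ?leq_addl.
have lowAB : low ((\sum_(x <- A) x) * (\sum_(x <- B) x)).
  rewrite mulnC {1}SB; apply: (closed_multiples h_gt0 low_closed) => //.
  - by apply/allP=> x /sA /cand0.
  - by apply/allP=> a aA; apply/allP=> b; apply: ltAB.
  - by rewrite -SB mulnC.
have : predC low ((\sum_(x <- A) x) * (\sum_(x <- B) x)).
  rewrite {1}SA; apply: (closed_multiples h_gt0 up_closed) => //.
  - by apply/allP=> x /sB /cand0.
  - by apply/allP=> b bB; apply/allPn; exists b; rewrite // ltnn.
  - by rewrite -SA.
by rewrite /= lowAB.
Qed.

(** * Subsequences with prescribed entries *)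

(** When [x] is the sum and [B] the summands, this makes the sum the first entry
    [a_1] of the subsequence; the next lemma makes it the last entry [a_k]. *)
Lemma filter_mem_first {s B : seq nat} {x : nat} :
    uniq s -> x \in s -> {in B, forall z, index x s < index z s} ->
  exists t, [seq z <- s | z \in x :: B] = x :: t.
Proof.
move=> us xs; case/splitPr: xs us => p1 p2 us ltB.
have xp1 : x \notin p1.
  by move: us; rewrite cat_uniq /= negb_or => /and3P[_ /andP[] ].
exists [seq z <- p2 | z \in x :: B].
rewrite filter_cat /= mem_head (_ : [seq z <- p1 | _] = [::]) //.
apply/eqP; rewrite -(negbK (_ == _)) -has_filter; apply/hasPn=> z zp1.
rewrite inE negb_or; apply/andP; split.
  by apply: contraNneq xp1 => <-.
apply/negP=> /ltB; rewrite !index_cat zp1 (negPf xp1).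
by move: zp1; rewrite -index_mem; lia.
Qed.

Lemma filter_mem_last {s B : seq nat} {x : nat} :
    uniq s -> x \in s -> {in B, forall z, index z s < index x s} ->
  exists t, [seq z <- s | z \in x :: B] = rcons t x.
Proof.
move=> us xs; case/splitPr: xs us => p1 p2 us ltB.
move: us; rewrite cat_uniq /= negb_or.
case/and4P=> _ /andP[xp1 /hasPn p12] xp2 _.
exists [seq z <- p1 | z \in x :: B].
rewrite filter_cat /= mem_head (_ : [seq z <- p2 | _] = [::]) ?cats1 //.
apply/eqP; rewrite -(negbK (_ == _)) -has_filter; apply/hasPn=> z zp2.
rewrite inE negb_or; apply/andP; split.
  by apply: contraNneq xp2 => <-.
have zp1 : z \notin p1 by apply: p12.
by apply/negP=> /ltB; rewrite !index_cat (negPf zp1) (negPf xp1) /= eqxx; lia.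
Qed.

Lemma one_line_uniq (n : nat) (p : 'S_n) : uniq (one_line p).
Proof.
rewrite map_inj_uniq ?enum_uniq // => i j [] /val_inj; exact: perm_inj.
Qed.

Lemma mem_one_line (n : nat) (p : 'S_n) (v : nat) :
  0 < v <= n -> v \in one_line p.
Proof.
case: v => // v /= vn; apply/mapP; exists ((p^-1)%g (Ordinal vn)).
  by rewrite mem_enum.
by rewrite permKV.
Qed.

Lemma inv_fact_div (M v : nat) : 0 < v <= M ->
  ((M`! %/ v)%:R^-1 = v%:R / M`!%:R :> rat)%R.
Proof.
move=> vM; have vdvd : v %| M`! by apply: dvdn_fact.
have v0 : (v%:R != 0 :> rat)%R by rewrite Num.Theory.pnatr_eq0; lia.
rewrite -{2}(divnK vdvd) GRing.natrM GRing.invfM GRing.mulrCA.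
by rewrite GRing.mulfV // GRing.mulr1.
Qed.

Theorem corollary6p5 (k : nat) (hk : (3 <= k)%N) :
  exists N : nat, forall n : nat, (N <= n)%N -> forall p : 'S_n,
    exists a : seq nat,
      [/\ subseq a (one_line p), size a = k & two_inverse_additive a].
Proof.
have [M extM] : exists M, _ := @extremal_sum k.-2 ltac:(lia).
exists M`! => n leMn p.
(* [w] turns sums into sums of reciprocals, by [inv_fact_div]. *)
set s := one_line p; pose w v := M`! %/ v.
have us : uniq s := one_line_uniq n p.
have w_gt0 v : 0 < v <= M -> 0 < w v.
  move=> vM; rewrite divn_gt0; last by lia.
  by apply: dvdn_leq; rewrite ?fact_gt0 ?dvdn_fact.
have ws v : 0 < v <= M -> w v \in s.
  move=> vM; apply: mem_one_line; rewrite w_gt0 //=.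
  by apply: leq_trans leMn; apply: leq_div.
have w_inj : {in [pred v | 0 < v <= M] &, injective w}.
  move=> u v; rewrite !inE => uM vM euv.
  have := divnK (dvdn_fact uM); rewrite -[X in _ = X](divnK (dvdn_fact vM)).
  rewrite -/(w u) -/(w v) euv => /eqP.
  by rewrite eqn_pmul2l ?w_gt0 // => /eqP.
have f_inj : {in [pred v | 0 < v <= M] &, injective (fun v => index (w v) s)}.
  move=> u v uM vM eqi; apply: w_inj => //.
  by rewrite -(nth_index 0 (ws u uM)) eqi nth_index ?ws.
have [ys [uys szys ys0 xM ext]] := extM _ f_inj.
set x := \sum_(y <- ys) y in xM ext.
have ysM y : y \in ys -> 0 < y <= M.
  move=> yys; rewrite (allP ys0 y yys) /=; apply: leq_trans xM.
  by rewrite /x (big_rem y) //= leq_addr.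
have x_in : 0 < x <= M.
  rewrite xM andbT; case: (ys) szys ysM @x {xM ext} => // y ys' _.
  move=> /(_ y (mem_head _ _)).
  by rewrite big_cons; lia.
have xys : x \notin ys.
  by apply/negP=> xys; case: ext => /allP/(_ x xys); rewrite ltnn.
have vM v : v \in x :: ys -> 0 < v <= M.
  by rewrite inE => /orP[/eqP -> //|]; apply: ysM.
(* The permutation itself arranges the divisors of the relation. *)
pose a := [seq z <- s | z \in w x :: map w ys].
have perm_a : perm_eq a (map w (x :: ys)).
  apply: uniq_perm; first exact: filter_uniq.
    rewrite map_inj_in_uniq /= ?xys // => u v /vM uM /vM; exact: w_inj.
  move=> z; rewrite mem_filter; apply: andb_idr.
  rewrite -[w x :: _]/(map w (x :: ys)) => /mapP[v vx ->].
  by apply: ws; apply: vM.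
have a_gt0 : all (fun x => 0 < x) a.
  rewrite (perm_all _ perm_a); apply/allP=> z /mapP[v /vM vx ->]; exact: w_gt0.
have sum_a : (\sum_(z <- a) (z%:R : rat)^-1 = 2 / (w x)%:R)%R.
  rewrite (perm_big _ perm_a) big_map.
  rewrite (eq_big_seq (fun v => (v%:R / M`!%:R)%R)); last first.
    by move=> v /vM; apply: inv_fact_div.
  rewrite -GRing.mulr_suml big_cons -GRing.natr_sum -/x.
  by rewrite (inv_fact_div M x x_in); ring.
exists a; split; first exact: filter_subseq.
  by rewrite (perm_size perm_a) /= size_map szys; lia.
case: ext => /allP ext.
  have [|t def_a] := @filter_mem_first s (map w ys) (w x) us (ws x x_in).
    by move=> z /mapP[y yys ->]; apply: ext.
  by move: a_gt0 sum_a; rewrite /a def_a => a0 sa; split=> //; left.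
have [|t def_a] := @filter_mem_last s (map w ys) (w x) us (ws x x_in).
  by move=> z /mapP[y yys ->]; apply: ext.
move: a_gt0 sum_a; rewrite /a def_a; case: t {def_a} => [|b t] a0 sa.
  by split=> //; right.
by split=> //; right; rewrite last_rcons.
Qed.
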